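(* Let $\mathcal{G}$ be a finite set of points, $F^h$ be any continuous, monotone, proper approximation scheme on $\mathcal{G}$ (incorporating the Dirichlet data $g$ at the points of $\mathcal{G}\cap\partial\Omega$), and let $u^*:\mathcal{G}\to\mathbb{R}$ be the unique solution of $$F^h(x,u(x),u(x)-u(\cdot))=0,\quad x\in\mathcal{G}.$$ Let $G$ be the domain decomposition (DDM) map associated with $F^h$, the overlapping subdomains $\Omega_1,\ldots,\Omega_{N_d}$ and the weights $\lambda_1,\ldots,\lambda_{N_d}$. Then for any choice of $u^0:\mathcal{G}\to\mathbb{R}$, the DDM iteration $u^{k+1}=G[u^k]$, $k\ge 0$, converges to $u^*$ on $\mathcal{G}$ as $k\to\infty$.
   Context: Setting. $\Omega\subset\mathbb{R}^n$ is an open domain, $\mathcal{G}\subset\overline{\Omega}$ is a finite set of points (the grid), and $g:\mathcal{G}\cap\partial\Omega\to\mathbb{R}$ is given. Inequalities between grid functions are pointwise on $\mathcal{G}$. Scheme. A scheme is a function $F^h:\mathcal{G}\times\mathbb{R}\times\mathbb{R}^{\mathcal{G}}\to\mathbb{R}$, evaluated on a grid function $u:\mathcal{G}\to\mathbb{R}$ as $F^h(x,u(x),u(x)-u(\cdot))$, where $u(x)-u(\cdot)$ denotes the vector $(u(x)-u(y))_{y\in\mathcal{G}}$. It is continuous if it is continuous in its second and third arguments; monotone if it is a non-decreasing function of its second and third arguments (the third ordered componentwise); proper if there is $C>0$ such that $F^h(x,r,p)-F^h(x,s,p)\ge C(r-s)$ whenever $r\ge s$ (for all $x\in\mathcal{G}$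 and $p$). It incorporates the Dirichlet data: $F^h(x,u(x),u(x)-u(\cdot))=u(x)-g(x)$ for $x\in\mathcal{G}\cap\partial\Omega$. It is known that a continuous, monotone, proper scheme has a unique solution $u:\mathcal{G}\to\mathbb{R}$ of $F^h(x,u(x),u(x)-u(\cdot))=0$, $x\in\mathcal{G}$. Subdomains. $\Omega_1,\ldots,\Omega_{N_d}$ are open sets (overlaps allowed) with $\Omega=\bigcup_{i=1}^{N_d}\Omega_i$, and $\mathcal{G}_i=\mathcal{G}\cap\Omega_i$, with $\mathcal{G}_i^c$ the complement of $\mathcal{G}_i$. For grid functions $u_i,v$ the $i$th subdomain operator is $$F^h_i(x,u_i;v)=\begin{cases}F^h(x,u_i(x),u_i(x)-u_i(\cdot)),& x\in\mathcal{G}_i,\\ u_i(x)-g(x),& x\in\mathcal{G}\cap\partial\Omega,\\ u_i(x)-v(x),& x\in\mathcal{G}\cap\Omega\cap\mathcal{G}_i^c.\end{cases}$$ For fixed $v$ this is again a continuous, monotone, proper scheme in $u_i$, and $S_i^h[v]:\mathcal{G}\to\mathbb{R}$ denotes its unique solution: $F_i^h(x,S_i^h[v];v)=0$ for all $x\in\mathcal{G}$. Weights. $\lambda_1,\ldots,\lambda_{N_d}:\mathcal{G}\to[0,1]$ satisfy $\lambda_i(x)>0$ for $x\in\mathcal{G}_i$, $\lambda_i(x)=0$ for $x\in(\mathcal{G}\cap\Omega)\setminus\mathcal{G}_i$, and $\sum_{i=1}^{N_d}\lambda_i(x)=1$ for all $x\in\mathcal{G}$. DDM map. $G[u](x)=\sum_{i=1}^{N_d}\lambda_i(x)\,S_i^h[u](x)$,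 $x\in\mathcal{G}$. *)

(* Defs.v *)
From HB Require Import structures.
From mathcomp Require Import all_boot all_order all_algebra finmap.
From mathcomp Require Import all_classical all_reals all_analysis.

Set Implicit Arguments.
Unset Strict Implicit.
Unset Printing Implicit Defensive.

Import Order.TTheory GRing.Theory Num.Theory.
Import numFieldNormedType.Exports.

Local Open Scope classical_set_scope.
Local Open Scope ring_scope.

Definition boundary {T : topologicalType} (A : set T) : set T :=
  closure A `\` A°.

Section Schemes.
Variables (R : realType) (n : nat) (grid : {fset 'rV[R]_n}).

Definition gridfun := grid -> R.

Definition scheme := grid -> R -> gridfun -> R.

(* [eval_scheme F u x] is F(x, u(x), u(x) - u(.)). *)
Definition eval_scheme (F : scheme) (u : gridfun) (x : grid) : R :=
  F x (u x) (fun y => u x - u y).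

(* Joint continuity; the product topology on [grid -> R] is the usual topology
   of the finite-dimensional space R^grid. *)
Definition continuous_scheme (F : scheme) : Prop :=
  forall x, continuous (fun rp : R * {ptws grid -> R} => F x rp.1 rp.2).

Definition monotone_scheme (F : scheme) : Prop :=
  forall x (r s : R) (p q : gridfun),
    r <= s -> (forall y, p y <= q y) -> F x r p <= F x s q.

Definition proper_scheme (F : scheme) : Prop :=
  exists2 C : R, 0 < C &
    forall x (r s : R) (p : gridfun),
      s <= r -> C * (r - s) <= F x r p - F x s p.

Definition solves (F : scheme) (u : gridfun) : Prop :=
  forall x, eval_scheme F u x = 0.

(* The solution of F, unique when F is continuous, monotone and proper; the
   default value 0 is only taken when there is no solution at all. *)
Definition solution (F : scheme) : gridfun :=
  xget (fun=> 0) [set u | solves F u].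

(* The Dirichlet datum g lives on the grid points of the boundary: it is given
   by a function on the whole grid, of which no other value is ever used. *)
Definition incorporates_dirichlet (Omega : set 'rV[R]_n) (g : gridfun)
    (F : scheme) : Prop :=
  forall (u : gridfun) (x : grid),
    boundary Omega (val x) -> eval_scheme F u x = u x - g x.

Section DomainDecomposition.
Variables (Omega : set 'rV[R]_n) (g : gridfun) (F : scheme).
Variables (Nd : nat) (Omega_ : 'I_Nd -> set 'rV[R]_n).

(* For Omega open, Omega_ i included in Omega and the grid included in the
   closure of Omega, the three cases are disjoint and the last one is that of
   the grid points of Omega outside Omega_ i. *)
Definition subdomain_scheme (i : 'I_Nd) (v : gridfun) : scheme :=
  fun x r p =>
    if val x \in Omega_ i then F x r p
    else if val x \in boundary Omega then r - g x
    else r - v x.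

Definition subdomain_solution (i : 'I_Nd) (v : gridfun) : gridfun :=
  solution (subdomain_scheme i v).

Definition ddm_weights (lambda : 'I_Nd -> gridfun) : Prop :=
  [/\ forall i x, 0 <= lambda i x <= 1,
      forall i x, Omega_ i (val x) -> 0 < lambda i x,
      forall i x, Omega (val x) -> ~ Omega_ i (val x) -> lambda i x = 0
    & forall x, \sum_(i < Nd) lambda i x = 1].

Definition ddm_map (lambda : 'I_Nd -> gridfun) (u : gridfun) : gridfun :=
  fun x => \sum_(i < Nd) lambda i x * subdomain_solution i u x.

End DomainDecomposition.
End Schemes.

(* Main.v *)
Require Import Defs.
From HB Require Import structures.
From mathcomp Require Import all_boot all_order all_algebra finmap.
From mathcomp Require Import all_classical all_reals all_analysis.
From mathcomp Require Import lra.

Set Implicit Arguments.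
Unset Strict Implicit.
Unset Printing Implicit Defensive.

Import Order.TTheory GRing.Theory Num.Theory.
Import numFieldNormedType.Exports.

Local Open Scope classical_set_scope.
Local Open Scope ring_scope.

(** The DDM map G is shown to be a nonexpansion of the sup norm that fixes
    ustar and brings every other grid function strictly closer to ustar; on
    the finite dimensional space R^grid this forces its iterates to converge
    ([nonexpansive_iter_cvg]).  The order structure of the scheme supplies both
    properties.

    Everything rests on [strict_comparison].  Suppose u <= w + c on the grid,
    with c > 0, and u(x) = w(x) + c at some point x.  Every difference
    u(x) - u(y) is then at least w(x) - w(y), so monotonicity and properness
    give F[u](x) >= F[w](x) + C c > F[w](x).  Contact is therefore excluded
    wherever F[u] <= F[w].  Taking for x a point where u - w is maximal gives
    the comparison principle [comparison_up_to_shift].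

    A subdomain solution S[v] satisfies F[S[v]] = 0 inside the subdomain,
    equals g on the boundary and equals v elsewhere.  By the comparison
    principle, changing v by at most d changes S[v] by at most d
    ([subdomain_solution_nonexpansive]); by strict comparison, |S[v] - ustar|
    is strictly below the sup distance of v to ustar at every point of the
    subdomain ([subdomain_solution_strict]).  G averages these solutions.  A
    point of Omega lies in some subdomain, whose weight there is positive, and
    a grid point outside Omega lies on the boundary, where all the solutions
    agree with ustar; since the grid is finite, the pointwise strict
    inequalities make the sup distance decrease strictly.

    That the subdomain problems are solvable at all is Perron's method
    ([solution_exists]): the pointwise supremum of the subsolutions is a
    solution. *)

(** * The sup distance and iteration of nonexpansive maps *)

Section SupDistance.
Variables (R : realType) (T : finType).
Implicit Types (a u v w : T -> R) (c d e : R).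

Definition supdist u v : R := \big[Num.max/0]_x `|u x - v x|.

Lemma supdist_ge0 u v : 0 <= supdist u v.
Proof. exact: bigmax_ge_id. Qed.

Lemma ler_supdist u v x : `|u x - v x| <= supdist u v.
Proof. exact: le_bigmax. Qed.

Lemma supdist_le u v c :
  0 <= c -> (forall x, `|u x - v x| <= c) -> supdist u v <= c.
Proof. by move=> c0 uv; apply: bigmax_le. Qed.

Lemma supdist_lt u v c :
  0 < c -> (forall x, `|u x - v x| < c) -> supdist u v < c.
Proof. by move=> c0 uv; apply: bigmax_lt. Qed.

Lemma supdist_triangle v u w : supdist u w <= supdist u v + supdist v w.
Proof.
apply: supdist_le => [|x]; first by rewrite addr_ge0 ?supdist_ge0.
by rewrite (le_trans (ler_distD (v x) _ _))// lerD ?ler_supdist.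
Qed.

Lemma supdistC u v : supdist u v = supdist v u.
Proof. by apply: eq_bigr => x _; rewrite distrC. Qed.

Lemma supdist_le0 u v : supdist u v <= 0 -> u = v.
Proof.
move=> uv; apply/funext => x; apply/eqP; rewrite -subr_eq0 -normr_le0.
exact: le_trans (ler_supdist u v x) uv.
Qed.

Lemma near_supdist_lt (w : {ptws T -> R}) e :
  0 < e -> \forall v \near w, supdist v w < e.
Proof.
move=> e0; have : \forall v \near w, forall x, `|w x - v x| < e.
  apply: (@filter_forall _ _ (fun x v => `|w x - v x| < e)
    _ (nbhs_filter w)) => x.
  have px : v x @[v --> w] --> w x := @proj_continuous T (fun=> R) x w.
  exact: (px _ (nbhsx_ballx (w x) e e0)).
apply: (@filterS _ _ (nbhs_filter w)) => v vw.
by rewrite supdistC; exact: supdist_lt.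
Qed.

(** Bolzano-Weierstrass: the box of radius d around a is compact for pointwise
    convergence, by Tychonoff, and on a finite set pointwise neighbourhoods
    are sup-norm neighbourhoods ([near_supdist_lt]). *)
Lemma bounded_seq_cluster_point (u : nat -> T -> R) a d :
  (forall k, supdist (u k) a <= d) ->
  exists w, forall e N, 0 < e -> exists2 k, (N <= k)%N & supdist (u k) w < e.
Proof.
move=> ud.
pose K := [set f : {ptws T -> R} | forall x, f x \in `[a x - d, a x + d]].
have Kcompact : compact K.
  apply: (@tychonoff _ (fun=> R) (fun x => `[a x - d, a x + d]%classic)) => x.
  exact: segment_compact.
have uK : ((u : nat -> {ptws T -> R}) @ \oo) K.
  exists 0%N => // k _ x; rewrite /= in_itv /= -ler_distl.
  exact: le_trans (ler_supdist _ _ x) (ud k).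
have [w [_ clw]] := Kcompact _ _ uK.
exists w => e N e0.
have uN : ((u : nat -> {ptws T -> R}) @ \oo) (u @` [set k | (N <= k)%N]).
  by exists N => // k Nk; exists k.
have [_ [[k Nk <-] uw]] := clw _ _ uN (near_supdist_lt w e0).
by exists k.
Qed.

(** The distances to the fixed point a decrease, so the iterates accumulate at
    some w.  If w were not a, an iterate close to w would have a successor
    close to G w, nearer to a than w by a definite margin; later iterates
    could then not come back near w.  Hence w = a, and by monotonicity of the
    distances accumulation at a is convergence. *)
Lemma nonexpansive_iter_cvg (G : (T -> R) -> T -> R) a (u : nat -> T -> R) :
    (forall v w, supdist (G v) (G w) <= supdist v w) ->
    G a = a ->
    (forall v, 0 < supdist v a -> supdist (G v) a < supdist v a) ->
    (forall k, u k.+1 = G (u k)) ->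
  forall x, u k x @[k --> \oo] --> a x.
Proof.
move=> Gle Ga Glt uS.
have u_noninc j k : (j <= k)%N -> supdist (u k) a <= supdist (u j) a.
  elim: k => [|k IH]; first by rewrite leqn0 => /eqP ->.
  rewrite leq_eqVlt => /predU1P[-> //|/IH]; apply: le_trans.
  by rewrite uS -{1}Ga.
have [w uw] := bounded_seq_cluster_point (fun k => u_noninc 0%N k isT).
have wa : supdist w a <= 0.
  rewrite leNgt; apply/negP => /Glt Gw.
  (* The triangle inequalities below lose 2 e in total, and the gap is 4 e. *)
  pose e := (supdist w a - supdist (G w) a) / 4.
  have e0 : 0 < e by rewrite divr_gt0 ?subr_gt0.
  have [j _ ujw] := uw e 0%N e0.
  have [k jk ukw] := uw e j.+1 e0.
  have := u_noninc _ _ jk; rewrite uS => ukj.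
  have := supdist_triangle (u k) w a; rewrite (supdistC w (u k)).
  have := supdist_triangle (G w) (G (u j)) a.
  have := Gle (u j) w.
  move: e0 ujw ukw ukj; rewrite /e; lra.
have {}wa := supdist_le0 wa; rewrite {w}wa in uw.
move=> x; apply/cvgrPdist_lt => e e0.
have [N _ uN] := uw e 0%N e0.
exists N => // k /= Nk; rewrite distrC (le_lt_trans (ler_supdist _ _ x))//.
exact: le_lt_trans (u_noninc _ _ Nk) uN.
Qed.

Lemma translate_continuous w :
  continuous (fun t : R => (fun y => t - w y) : {ptws T -> R}).
Proof.
move=> t; apply/cvg_sup => y.
apply: (@continuous_comp_initial _ _ _ (@^~ y) (fun t' z => t' - w z)) => s.
by apply: cvgB; [exact: cvg_id|exact: cvg_cst].
Qed.

End SupDistance.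

(** * Comparison and solvability for monotone proper schemes *)

Section SchemeTheory.
Variables (R : realType) (n : nat) (grid : {fset 'rV[R]_n}).
Implicit Types (F : scheme grid) (u w : gridfun grid).

(** At a contact point the differences of u dominate those of w, so properness
    makes F[u] exceed F[w] there by a positive multiple of c. *)
Lemma strict_comparison F u w c (x : grid) :
    monotone_scheme F -> proper_scheme F -> 0 < c ->
    (forall y, u y <= w y + c) -> eval_scheme F u x <= eval_scheme F w x ->
  u x < w x + c.
Proof.
move=> Fmono [C C0 Fproper] c0 uwc Fuw.
rewrite lt_neqAle uwc andbT; apply/eqP => uxE.
have le1 : F x (w x + c) (fun y => w x - w y) <= eval_scheme F u x.
  rewrite /eval_scheme uxE; apply: Fmono => // y; have := uwc y; lra.
have := Fproper x (w x + c) (w x) (fun y => w x - w y).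
rewrite lerDl ltW// => /(_ isT); have : 0 < C * c by exact: mulr_gt0.
move: le1 Fuw; rewrite /eval_scheme; lra.
Qed.

(** A point where u - w is maximal is a contact point of u with w + c, for c
    this maximum; if c > d then neither alternative can hold there.  The
    second alternative accounts for the points of a subdomain problem where
    the values are prescribed. *)
Lemma comparison_up_to_shift F u w d :
    monotone_scheme F -> proper_scheme F -> 0 <= d ->
    (forall x, eval_scheme F u x <= eval_scheme F w x \/ u x <= w x + d) ->
  forall x, u x <= w x + d.
Proof.
move=> Fmono Fproper d0 uw x0; rewrite leNgt; apply/negP => ux0.
have [x _ xmax] := @arg_maxP _ _ _ x0 predT (fun x => u x - w x) isT.
have c0 : 0 < u x - w x by have := xmax x0 isT; move: ux0 d0 => /=; lra.
have dc : d < u x - w x by have := xmax x0 isT; move: ux0 => /=; lra.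
have uwc y : u y <= w y + (u x - w x) by have := xmax y isT => /=; lra.
case: (uw x) => [Fuw|]; last by lra.
by have := strict_comparison Fmono Fproper c0 uwc Fuw; lra.
Qed.

(** The left-hand side is not quite the residual at x of w with its value at x
    changed to t, for which the entry y = x of the differences would stay 0.
    Monotonicity of F compares the two. *)
Lemma eval_scheme_shift_cvg F w (x : grid) :
  continuous_scheme F ->
  F x t (fun y => t - w y) @[t --> w x] --> eval_scheme F w x.
Proof.
move=> Fcont.
pose pair t : R * {ptws grid -> R} := (t, fun y => t - w y).
have pair_cvg : pair t @[t --> w x] --> pair (w x).
  have := @translate_continuous R grid w (w x).
  exact: (@cvg_pair R R {ptws grid -> R} (nbhs (w x)) (nbhs (w x))
    (nbhs ((fun y => w x - w y) : {ptws grid -> R}))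
    (nbhs_filter _) (nbhs_filter _) (nbhs_filter _) id _ cvg_id).
exact: (cvg_comp _ _ pair_cvg (Fcont x (pair (w x)))).
Qed.

(** Perron's method.  The constant - M is a subsolution and the constant M
    bounds every subsolution, so the supremum w of the subsolutions is finite.
    A subsolution almost touching w at x shows F[w](x) <= 0, and F[w](x) < 0
    would allow w to be raised at x: raising one value only lowers the
    residual at the other points. *)
Lemma solution_exists F :
  continuous_scheme F -> monotone_scheme F -> proper_scheme F ->
  exists u, solves F u.
Proof.
move=> Fcont Fmono Fproper; have [C C0 FC] := Fproper.
pose sub u := forall x, eval_scheme F u x <= 0.
pose M := (\big[Num.max/0]_x `|F x 0 (fun=> 0)|) / C.
have M0 : 0 <= M by rewrite divr_ge0 ?bigmax_ge_id ?ltW.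
have CM x : `|F x 0 (fun=> 0)| <= C * M.
  by rewrite /M mulrC divfK ?gt_eqF//; exact: le_bigmax.
have cstE c (x : grid) : eval_scheme F (fun=> c) x = F x c (fun=> 0).
  by rewrite /eval_scheme; congr F; apply/funext => y; rewrite subrr.
have subN : sub (fun=> - M).
  move=> x; rewrite cstE; have := CM x; rewrite ler_norml => /andP[_].
  by have := FC x 0 (- M) (fun=> 0); rewrite oppr_le0 => /(_ M0); lra.
have ub u x : sub u -> u x <= M.
  move=> usub; rewrite -[M]addr0; move: x.
  apply: (@comparison_up_to_shift F u (fun=> M)) => // x; left.
  apply: (le_trans (usub x)); rewrite cstE.
  have := CM x; rewrite ler_norml => /andP[+ _].
  by have := FC x M 0 (fun=> 0) M0; lra.
pose E (x : grid) : set R := [set u x | u in sub].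
have supE x : has_sup (E x).
  split; first by exists (- M), (fun=> - M).
  by exists M => _ [u usub <-]; exact: ub.
pose w : gridfun grid := fun x => sup (E x).
have le_w u x : sub u -> u x <= w x.
  by move=> usub; apply: sup_upper_bound => //; exists u.
have w_sub : sub w.
  move=> x; rewrite leNgt; apply/negP => Fwx.
  have Fcvg := eval_scheme_shift_cvg (w := w) (x := x) Fcont.
  have /(_ _ _ Fwx) := @cvgr_gt _ _ _ _ _ _ Fcvg.
  move=> /nbhs_ballP[e /= e0 We].
  have [_ [u usub <-] ux] := sup_adherent e0 (supE x).
  (* u x is within e of w x, and the differences against w lie below those
     against u, because u <= w. *)
  have uwx := le_w u x usub.
  have : 0 < F x (u x) (fun y => u x - w y).
    apply: We; rewrite /ball /= ger0_norm; move: ux uwx; rewrite /w; lra.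
  apply/negP; rewrite -leNgt; apply: le_trans (usub x).
  by apply: Fmono => // y; have := le_w u y usub; lra.
exists w => x; apply/le_anti; rewrite w_sub /= leNgt; apply/negP => Fwx.
have Fcvg := eval_scheme_shift_cvg (w := w) (x := x) Fcont.
have /(_ _ _ Fwx) := @cvgr_lt _ _ _ _ _ _ Fcvg.
move=> /nbhs_ballP[e /= e0 We].
(* Any value strictly between w x and w x + e keeps the residual at x
   negative. *)
pose t := w x + e / 2.
pose w' : gridfun grid := fun y => if y == x then t else w y.
have ww' y : w y <= w' y.
  by rewrite /w'; case: eqP => [->|//]; rewrite /t; lra.
have w'_sub : sub w'.
  move=> y; rewrite /eval_scheme {1 2}/w'; case: (eqVneq y x) => [->|yx].
    apply: (@le_trans _ _ (F x t (fun z => t - w z))).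
      by apply: Fmono => // z; have := ww' z; lra.
    by apply: ltW; apply: We; rewrite /ball /= /t ler0_norm; lra.
  apply: le_trans (w_sub y).
  by apply: Fmono => // z; have := ww' z; lra.
have := le_w w' x w'_sub; rewrite /w' eqxx /t; lra.
Qed.

Lemma solutionP F :
  continuous_scheme F -> monotone_scheme F -> proper_scheme F ->
  solves F (solution F).
Proof.
by move=> Fc Fm Fp; exact: (xgetPex _ (solution_exists Fc Fm Fp)).
Qed.

End SchemeTheory.

(** * The subdomain solution operator *)

Section SubdomainSolver.
Variables (R : realType) (n : nat) (grid : {fset 'rV[R]_n}).
Variables (Omega : set 'rV[R]_n) (g : gridfun grid) (F : scheme grid).
Hypotheses (F_continuous : continuous_scheme F)
  (F_monotone : monotone_scheme F) (F_proper : proper_scheme F).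
Variables (Nd : nat) (Omega_ : 'I_Nd -> set 'rV[R]_n) (i : 'I_Nd).
Implicit Types (v w : gridfun grid) (x : grid).

Local Notation subscheme := (subdomain_scheme Omega g F Omega_ i).
Local Notation S := (subdomain_solution Omega g F Omega_ i).

Lemma subdomain_scheme_continuous v : continuous_scheme (subscheme v).
Proof.
move=> x z; rewrite /subdomain_scheme.
case: (val x \in Omega_ i); first exact: F_continuous.
have minus_cst c : continuous (fun r : R => r - c).
  by move=> r; apply: cvgB; [exact: cvg_id|exact: cvg_cst].
by case: (val x \in boundary Omega);
  exact: (cvg_comp fst (fun r => r - _) cvg_fst (minus_cst _ z.1)).
Qed.

Lemma subdomain_scheme_monotone v : monotone_scheme (subscheme v).
Proof.
move=> x r s p q rs pq; rewrite /subdomain_scheme.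
by case: ifP => _; [exact: F_monotone|case: ifP => _; rewrite lerB].
Qed.

Lemma subdomain_scheme_proper v : proper_scheme (subscheme v).
Proof.
have [C C0 FC] := F_proper.
exists (Num.min C 1) => [|x r s p sr]; first by rewrite lt_min C0 ltr01.
have sr0 : 0 <= r - s by rewrite subr_ge0.
rewrite /subdomain_scheme; case: ifP => _.
  by apply: le_trans (FC _ _ _ _ sr); rewrite ler_wpM2r// ge_min lexx.
have min1 : Num.min C 1 * (r - s) <= r - s.
  by rewrite -[leRHS]mul1r ler_wpM2r// ge_min lexx orbT.
by case: ifP => _; move: min1; lra.
Qed.

Lemma subdomain_solutionP v : solves (subscheme v) (S v).
Proof.
by apply: solutionP; [exact: subdomain_scheme_continuous
  |exact: subdomain_scheme_monotone|exact: subdomain_scheme_proper].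
Qed.

Lemma subdomain_solution_inside v x :
  Omega_ i (val x) -> eval_scheme F (S v) x = 0.
Proof.
move=> xi; have := subdomain_solutionP v x.
by rewrite /eval_scheme /subdomain_scheme mem_set.
Qed.

Lemma subdomain_solution_boundary v x :
  ~ Omega_ i (val x) -> boundary Omega (val x) -> S v x = g x.
Proof.
move=> xi xb; have := subdomain_solutionP v x.
rewrite /eval_scheme /subdomain_scheme memNset// mem_set//.
by move/eqP; rewrite subr_eq0 => /eqP.
Qed.

(** Stated for arbitrary solutions u and u', so that d = 0 and v = w also yields
    uniqueness. *)
Lemma subdomain_solution_le v w d u u' :
    0 <= d -> (forall x, v x <= w x + d) ->
    solves (subscheme v) u -> solves (subscheme w) u' ->
  forall x, u x <= u' x + d.
Proof.
move=> d0 vw uv u'w.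
apply: (comparison_up_to_shift F_monotone F_proper d0) => x.
have := uv x; have := u'w x; rewrite /eval_scheme /subdomain_scheme.
case: ifP => _; first by move=> -> ->; left.
by case: ifP => _; right; have := vw x; lra.
Qed.

Lemma subdomain_solution_nonexpansive v w :
  supdist (S v) (S w) <= supdist v w.
Proof.
apply: supdist_le => [|x]; first exact: supdist_ge0.
have vw y : v y <= w y + supdist v w.
  by have := ler_supdist v w y; rewrite ler_norml; lra.
have wv y : w y <= v y + supdist v w.
  by have := ler_supdist v w y; rewrite ler_norml; lra.
have := subdomain_solution_le (supdist_ge0 v w) vw
  (subdomain_solutionP v) (subdomain_solutionP w) x.
have := subdomain_solution_le (supdist_ge0 v w) wv
  (subdomain_solutionP w) (subdomain_solutionP v) x.
by rewrite ler_norml; lra.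
Qed.

(** Inside the subdomain S v and w both have zero residual, and they differ by
    at most the distance of v to w; strict comparison, in both directions,
    excludes equality. *)
Lemma subdomain_solution_strict v w x :
    S w = w -> 0 < supdist v w -> Omega_ i (val x) ->
  `|S v x - w x| < supdist v w.
Proof.
move=> Sw d0 xi; have Sd y : `|S v y - w y| <= supdist v w.
  rewrite -{1}Sw; apply: le_trans (subdomain_solution_nonexpansive v w).
  exact: ler_supdist.
have Fv : eval_scheme F (S v) x = 0 by exact: subdomain_solution_inside.
have Fw : eval_scheme F w x = 0.
  by rewrite -Sw; exact: subdomain_solution_inside.
have lt1 : S v x < w x + supdist v w.
  apply: (strict_comparison F_monotone F_proper d0); last by rewrite Fv Fw.
  by move=> y; have := Sd y; rewrite ler_norml; lra.
have lt2 : w x < S v x + supdist v w.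
  apply: (strict_comparison F_monotone F_proper d0); last by rewrite Fv Fw.
  by move=> y; have := Sd y; rewrite ler_norml; lra.
by rewrite ltr_norml; lra.
Qed.

(** w solves the subdomain problem with its own values as data: at boundary
    points because F[w] = w - g = 0, elsewhere trivially.  Uniqueness
    identifies it with S w. *)
Lemma subdomain_solution_fixed w :
    incorporates_dirichlet Omega g F -> solves F w -> S w = w.
Proof.
move=> Fg Fw; have ww x : w x <= w x + 0 by rewrite addr0.
have wS : solves (subscheme w) w.
  move=> x; rewrite /eval_scheme /subdomain_scheme.
  case: ifP => _; first exact: Fw.
  case: ifPn => [/set_mem xb|_]; last by rewrite subrr.
  by rewrite -Fg.
have Sw := subdomain_solutionP w.
apply/funext => x; apply/le_anti/andP; split; rewrite -[leRHS]addr0.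
  exact: (subdomain_solution_le _ ww).
exact: (subdomain_solution_le _ ww).
Qed.

End SubdomainSolver.

(** * Averaging and convergence of the iteration *)

Lemma norm_convex_comb_le (R : realDomainType) (I : finType) (l s : I -> R)
    (a c : R) :
    (forall i, 0 <= l i) -> \sum_i l i = 1 -> (forall i, `|s i - a| <= c) ->
  `|\sum_i l i * s i - a| <= c.
Proof.
move=> l0 l1 sc; rewrite -[a]mul1r -l1 mulr_suml -sumrB.
rewrite (le_trans (ler_norm_sum _ _ _))// -[c]mul1r -l1 mulr_suml.
by apply: ler_sum => i _; rewrite -mulrBr normrM ger0_norm// ler_wpM2l.
Qed.

Lemma norm_convex_comb_lt (R : realDomainType) (I : finType) (l s : I -> R)
    (a c : R) (i0 : I) :
    (forall i, 0 <= l i) -> \sum_i l i = 1 -> (forall i, `|s i - a| <= c) ->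
    0 < l i0 -> `|s i0 - a| < c ->
  `|\sum_i l i * s i - a| < c.
Proof.
move=> l0 l1 sc li0 si0; rewrite -[a]mul1r -l1 mulr_suml -sumrB.
rewrite (le_lt_trans (ler_norm_sum _ _ _))// -[c]mul1r -l1 mulr_suml.
rewrite (bigD1 i0)//= [ltRHS](bigD1 i0)//= ltr_leD//.
  by rewrite -mulrBr normrM gtr0_norm// ltr_pM2l.
by apply: ler_sum => i _; rewrite -mulrBr normrM ger0_norm// ler_wpM2l.
Qed.

Theorem theorem12 (R : realType) (n : nat)
  (Omega : set 'rV[R]_n) (Omega_open : open Omega)
  (grid : {fset 'rV[R]_n})
  (grid_sub : forall x : grid, closure Omega (val x))
  (g : gridfun grid) (F : scheme grid)
  (F_continuous : continuous_scheme F)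
  (F_monotone : monotone_scheme F)
  (F_proper : proper_scheme F)
  (F_dirichlet : incorporates_dirichlet Omega g F)
  (Nd : nat) (Omega_ : 'I_Nd -> set 'rV[R]_n)
  (Omega_i_open : forall i, open (Omega_ i))
  (Omega_cover : Omega = \bigcup_i Omega_ i)
  (lambda : 'I_Nd -> gridfun grid)
  (lambda_weights : ddm_weights Omega Omega_ lambda)
  (ustar : gridfun grid) (ustar_solves : solves F ustar)
  (u0 : gridfun grid) (u : nat -> gridfun grid)
  (u_init : u 0%N = u0)
  (u_step : forall k, u k.+1 = ddm_map Omega g F Omega_ lambda (u k)) :
  forall x : grid, u k x @[k --> \oo] --> ustar x.
Proof.
have weight_ge0 i x : 0 <= lambda i x.
  by have [/(_ i x)/andP[]] := lambda_weights.
have weight_gt0 i (x : grid) : Omega_ i (val x) -> 0 < lambda i x.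
  by have [_ + _ _] := lambda_weights; apply.
have weight_sum x : \sum_(i < Nd) lambda i x = 1.
  by have [_ _ _] := lambda_weights; apply.
pose S i := subdomain_solution Omega g F Omega_ i.
have S_fixed i : S i ustar = ustar by exact: subdomain_solution_fixed.
have S_nonexp i v w : supdist (S i v) (S i w) <= supdist v w.
  exact: subdomain_solution_nonexpansive.
pose G := ddm_map Omega g F Omega_ lambda.
have G_fixed : G ustar = ustar.
  apply/funext => x; rewrite /G /ddm_map.
  under eq_bigr do rewrite [subdomain_solution _ _ _ _ _ _]S_fixed.
  by rewrite -mulr_suml weight_sum mul1r.
have G_nonexp v w : supdist (G v) (G w) <= supdist v w.
  apply: supdist_le => [|x]; first exact: supdist_ge0.
  (* The difference is itself a weighted average, compared here with 0. *)
  rewrite /G /ddm_map -sumrB -[X in `|X|]subr0.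
  under eq_bigr do rewrite -mulrBr.
  apply: norm_convex_comb_le => // i; rewrite subr0.
  exact: le_trans (ler_supdist (S i v) (S i w) x) (S_nonexp i v w).
have G_strict v : 0 < supdist v ustar -> supdist (G v) ustar < supdist v ustar.
  move=> d0; apply: supdist_lt => // x; rewrite /G /ddm_map.
  have S_le i : `|S i v x - ustar x| <= supdist v ustar.
    rewrite -[X in `|_ - X x|](S_fixed i).
    exact: le_trans (ler_supdist _ _ x) (S_nonexp i v ustar).
  have [Ox|Ox] := pselect (Omega (val x)).
    have [i _ xi] : (\bigcup_i Omega_ i) (val x) by rewrite -Omega_cover.
    apply: (norm_convex_comb_lt (i0 := i)) => //; first exact: weight_gt0.
    exact: subdomain_solution_strict.
  have xb : boundary Omega (val x).
    by split; [exact: grid_sub|move=> /interior_subset].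
  have xi i : ~ Omega_ i (val x).
    by move=> xi; apply: Ox; rewrite Omega_cover; exists i.
  have S_bd i w : S i w x = g x by exact: subdomain_solution_boundary.
  have -> : \sum_(i < Nd) lambda i x * S i v x =
            \sum_(i < Nd) lambda i x * S i ustar x.
    by apply: eq_bigr => i _; rewrite !S_bd.
  under eq_bigr do rewrite S_fixed.
  by rewrite -mulr_suml weight_sum mul1r subrr normr0.
exact: nonexpansive_iter_cvg G_nonexp G_fixed G_strict u_step.
Qed.
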